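(* Let $p$ be an odd prime, let $\lambda\in\mathbb{Z}_p$, and let $q\in\mathbb{C}_p$ with $|1-q|_p<p^{-1/(p-1)}$. For every integer $n\ge 0$, $$\frac{(-1)^n}{q^n}\,\frac{\widehat{Bl}_{n,q}(\lambda)}{n!}=\sum_{\ell=0}^n\binom{n-1}{\ell-1}\frac{Bl_{\ell,q}(\lambda)}{\ell!\,q^\ell},$$ where $\binom{n-1}{\ell-1}$ is read as $\binom{n-1}{n-\ell}$ (so it is $0$ for $\ell=0$, $n\ge1$, and equals $1$ for $n=\ell=0$).
   Context: $\mathbb{Z}_p$ is the ring of $p$-adic integers and $\mathbb{C}_p$ is the completion of an algebraic closure of $\mathbb{Q}_p$, with norm normalized by $|p|_p=1/p$. For a continuous function $f$ on $\mathbb{Z}_p$ (with values in $\mathbb{C}_p$), the fermionic $p$-adic integral is $$\int_{\mathbb{Z}_p} f(y)\,d\mu_{-1}(y)=\lim_{N\to\infty}\sum_{y=0}^{p^N-1}f(y)(-1)^y.$$ The $q$-product is $(z)_{n,q}=z(z-q)(z-2q)\cdots(z-(n-1)q)$ for $n\ge 0$, with $(z)_{0,q}=1$. The $q$-Boole numbers and the $q$-Boole numbers of the second kind are, respectively, $$Bl_{n,q}(\lambda)=\int_{\mathbb{Z}_p}(\lambda y)_{n,q}\,d\mu_{-1}(y),\qquad \widehat{Bl}_{n,q}(\lambda)=\int_{\mathbb{Z}_p}(-\lambda y)_{n,q}\,d\mu_{-1}(y)\quad(n\ge 0).$$ *)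

(* Defs.v *)
From HB Require Import structures.
From mathcomp Require Import all_boot all_order all_algebra.
From mathcomp Require Import all_classical all_reals topology.
(* Not [all_analysis]: once [PseudoMetricNormedZmod] is declared, HB refuses a
   structure joining a field and a pseudometric space without a Z-module norm. *)

Set Implicit Arguments.
Unset Strict Implicit.
Unset Printing Implicit Defensive.

Import Order.TTheory GRing.Theory Num.Theory.
Local Open Scope classical_set_scope.
Local Open Scope ring_scope.

(* The norms of [NormedZmodule] satisfy |x *+ n| = |x| *+ n, so they are never
   non-archimedean: p-adic absolute values need a structure of their own. The
   topology is the one of the metric |x - y|, by [ball_absvE]. *)
HB.mixin Record Field_isUltrametric (R : realType) K
    & GRing.Field K & CompletePseudoMetric R K := {
  absv : K -> R ;
  absv_ge0 : forall x, 0 <= absv x ;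
  absv_eq0 : forall x : K, (absv x == 0) = (x == 0) ;
  absvM : forall x y : K, absv (x * y) = absv x * absv y ;
  absvD : forall x y : K, absv (x + y) <= Num.max (absv x) (absv y) ;
  ball_absvE : forall (x : K) (e : R), ball x e = [set y : K | absv (x - y) < e]
}.

#[short(type="ultrametricFieldType")]
HB.structure Definition UltrametricField (R : realType) :=
  {K of GRing.Field K & CompletePseudoMetric R K & Field_isUltrametric R K}.

Section padic_subsets.
Context {R : realType} (K : ultrametricFieldType R).

(* When |p| = 1/p, the absolute value induces the p-adic one on the rational
   numbers, and, K being complete, the closures of the images of the rational
   numbers and of the integers are their p-adic completions. *)
Definition padic_numbers : set K := closure (range (@ratr K)).

Definition padic_integers : set K := closure (range (fun z : int => z%:~R : K)).

Definition padic_polys : set {poly K} := [set P | forall i, padic_numbers P`_i].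

Definition padic_algebraic : set K :=
  [set x | exists P, [/\ padic_polys P, P != 0 & root P x]].

End padic_subsets.

(* K is the completion of an algebraic closure of Q_p: Q_p is [padic_numbers],
   its algebraic closure is [padic_algebraic], K is complete and
   [padic_algebraic] is dense in K. These properties determine K, with its
   absolute value, up to isometric isomorphism. *)
HB.mixin Record Ultrametric_isPadicComplex (p : nat) (R : realType) K
    & UltrametricField R K := {
  absv_p : absv (p%:R : K) = p%:R^-1 ;
  padic_polys_root : forall P : {poly K},
    padic_polys P -> (1 < size P)%N -> exists x : K, root P x ;
  padic_algebraic_dense : closure (@padic_algebraic R K) = setT
}.

#[short(type="padicComplexType")]
HB.structure Definition PadicComplex (p : nat) (R : realType) :=
  {K of UltrametricField R K & Ultrametric_isPadicComplex p R K}.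

Section boole_numbers.
Context {R : realType} {p : nat} (Cp : padicComplexType p R).

(* Only the values of f on Z_p matter. *)
Definition fermionic_integral (f : Cp -> Cp) : Cp :=
  lim ((fun N => \sum_(0 <= y < (p ^ N)%N) f y%:R * (-1) ^+ y) @ \oo).

Definition qprod (q : Cp) (n : nat) (z : Cp) : Cp :=
  \prod_(i < n) (z - i%:R * q).

Definition Bl (q lambda : Cp) (n : nat) : Cp :=
  fermionic_integral (fun y => qprod q n (lambda * y)).

Definition Bl_hat (q lambda : Cp) (n : nat) : Cp :=
  fermionic_integral (fun y => qprod q n (- lambda * y)).

End boole_numbers.

(* Main.v *)
Require Import Defs.
From mathcomp Require Import all_boot all_order all_algebra.
From mathcomp Require Import all_classical all_reals all_analysis.
From mathcomp Require Import ring.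
Import Order.TTheory GRing.Theory Num.Theory.
Local Open Scope ring_scope.

(** In x = lambda y, both sides integrate polynomials, and the identity is the
    integral of a polynomial identity. Put B_n(x) = (x)_{n,q} / (n! q^n), which
    is the binomial coefficient of x / q over n. Reversing the order of the
    factors gives (-1)^n (-x)_{n,q} = (x + (n - 1) q)_{n,q} ([qprod_opp]), and
    the Vandermonde convolution expands B_n (x + m q) as the sum of the
    C(m, n - l) B_l (x) ([qbin_vandermonde]); m = n - 1 gives the integrand.

    What remains is that the fermionic integral, a limit, is linear on
    polynomials. Since 2 is invertible, every polynomial f has a primitive g
    with g (x + 1) + g (x) = 2 f (x) ([euler_primitive]; for f = x^k it is the
    Euler polynomial E_k). The alternating sum of f over 0 <= y < M then
    telescopes to (g (0) + g (M)) / 2 for odd M, and for M = p^N, which tends to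
    0 p-adically, it tends to g (0) ([fermionic_integral_primitive]). Hence the
    integral of f is g (0), and linear combinations of integrands follow from
    those of their primitives ([fermionic_integral_sum]). This gives existence
    and value of the limits at once.

    Dividing by n! and by 2 requires characteristic 0, which follows from
    |p| = 1 / p ([padic_natr_neq0]); q is nonzero because |1 - q| < 1. *)

(** * Ultrametric absolute values *)

Section absolute_value.
Context {R : realType} (K : ultrametricFieldType R).
Implicit Types x y : K.

Lemma absv0 : absv (0 : K) = 0.
Proof. by apply/eqP; rewrite absv_eq0. Qed.

Lemma absv1 : absv (1 : K) = 1.
Proof.
have a0 : absv (1 : K) != 0 by rewrite absv_eq0 oner_neq0.
by apply: (mulfI a0); rewrite -absvM !mulr1.
Qed.

Lemma absvN x : absv (- x) = absv x.
Proof.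
suff a1 : absv (-1 : K) = 1 by rewrite -mulN1r absvM a1 mul1r.
have /eqP := absv1; rewrite -[X in absv X]mulr1 -mulrNN absvM -expr2.
by rewrite sqrp_eq1 ?absv_ge0// => /eqP.
Qed.

Lemma absvB x y : absv (x - y) = absv (y - x).
Proof. by rewrite -absvN opprB. Qed.

Lemma absv_nat_le1 (m : nat) : absv (m%:R : K) <= 1.
Proof.
elim: m => [|m IHm]; first by rewrite absv0.
by rewrite -natr1 (le_trans (absvD _ _))// ge_max IHm absv1 lexx.
Qed.

Lemma ultrametric_hausdorff : hausdorff_space K.
Proof.
rewrite (ball_hausdorff K) => x y xy.
have e0 : 0 < absv (x - y).
  by rewrite lt_neqAle absv_ge0 eq_sym absv_eq0 subr_eq0 xy.
exists (PosNum e0, PosNum e0); rewrite !ball_absvE/=.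
apply/eqP; rewrite -subset0 => z /= [xz yz].
have := absvD (x - z) (z - y); rewrite addrA subrK (absvB z y).
by rewrite le_max leNgt xz leNgt yz.
Qed.

(** The bound is uniform on the closed unit ball, so that it applies to the
    points p^N and yields the continuity of polynomials at 0. *)
Lemma horner_bounded (h : {poly K}) :
  exists2 C : R, 0 < C & forall x, absv x <= 1 -> absv h.[x] <= C.
Proof.
elim/poly_ind: h => [|h c [C C0 hC]].
  by exists 1 => // x _; rewrite horner0 absv0.
exists (Num.max C (absv c)) => [|x x1]; first by rewrite lt_max C0.
rewrite hornerD hornerM hornerX hornerC.
rewrite (le_trans (absvD _ _))// ge_max !le_max lexx orbT andbT absvM.
by apply/orP; left; rewrite -[C]mulr1 ler_pM ?absv_ge0// hC.
Qed.

End absolute_value.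

Section characteristic.
Context {R : realType} {p : nat} (p_prime : prime p)
  (Cp : padicComplexType p R).

(** Write m = k p^j with k prime to p. If k vanished in Cp, a Bezout relation
    u p - v k = 1 would give |u| / p = 1 although |u| <= 1. *)
Lemma padic_natr_neq0 (m : nat) : (0 < m)%N -> m%:R != 0 :> Cp.
Proof.
have p0 : p%:R != 0 :> Cp.
  by rewrite -absv_eq0 absv_p invr_eq0 pnatr_eq0 -lt0n prime_gt0.
move=> m0; have [k pk ->] := pfactor_coprime p_prime m0.
rewrite natrM natrX mulf_neq0 ?expf_neq0//; apply/eqP => k0.
have /(coprimeP _ (prime_gt0 p_prime)) [[u v] /= uv1] := pk.
have /(congr1 (fun a => absv (a%:R : Cp))) : (u * p = v * k + 1)%N.
  by rewrite -uv1 addnC subnK// ltnW// -subn_gt0 uv1.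
rewrite natrD !natrM k0 mulr0 add0r absvM absv_p absv1 => up1.
have : absv (u%:R : Cp) * p%:R^-1 <= p%:R^-1.
  by rewrite ler_piMl ?invr_ge0// absv_nat_le1.
by rewrite up1 leNgt invf_lt1 ?ltr0n ?ltr1n ?prime_gt1 ?prime_gt0.
Qed.

Lemma absv_powp_lt (e : R) : 0 < e ->
  (\forall N \near \oo, absv ((p ^ N)%:R : Cp) < e)%classic.
Proof.
move=> e0; have pR : 0 < p%:R :> R by rewrite ltr0n prime_gt0.
have absvX N : absv ((p ^ N)%:R : Cp) = p%:R^-1 ^+ N.
  elim: N => [|N IHN]; first by rewrite expn0 absv1.
  by rewrite expnS natrM absvM absv_p IHN exprS.
near=> N; rewrite absvX exprVn invf_plt ?posrE ?exprn_gt0// -natrX.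
apply: (@lt_trans _ _ N%:R); last by rewrite ltr_nat ltn_expl// prime_gt1.
near: N; exact: nbhs_infty_gtr.
Unshelve. all: by end_near. Qed.

End characteristic.

(** * Fermionic integrals of polynomials *)

(** A shift preserves the degree and the leading coefficient, so the difference
    operator lowers the degree. *)
Lemma size_shift_sub {K : idomainType} (h : {poly K}) :
  h != 0 -> (size (h - (h \Po ('X + 1))%R)%R < size h)%N.
Proof.
move=> h0; have sX : size ('X + 1 : {poly K}) = 2%N.
  by rewrite -[1]/(1%:P) size_XaddC.
have sh := size_comp_poly2 h sX.
have sh1 : (size h).-1.+1 = size h by rewrite prednK// size_poly_gt0.
rewrite -[X in (_ < X)%N]sh1 ltnS; apply/leq_sizeP => j.
rewrite leq_eqVlt coefB => /predU1P[<-|lt_j].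
  rewrite -{2}sh -!lead_coefE lead_coef_comp ?sX//.
  by rewrite -[1]/(1%:P) lead_coefXaddC expr1n mulr1 subrr.
by rewrite !nth_default ?subr0 ?sh// -sh1.
Qed.

(** The operator T sending g to g (x + 1) + g (x) is 2 plus the difference
    operator, which is nilpotent on polynomials of bounded degree. Concretely,
    f itself is a primitive up to the error f (x) - f (x + 1), of smaller
    degree, which is corrected by induction. *)
Lemma euler_primitive {K : fieldType} : 2 != 0 :> K ->
  forall f : {poly K},
  exists g : {poly K}, forall x, g.[x + 1] + g.[x] = 2 * f.[x].
Proof.
move=> two f; have [m] := ubnP (size f); elim: m => // m IHm in f *.
rewrite ltnS => sf; have [->|f0] := eqVneq f 0.
  by exists 0 => x; rewrite !horner0 mulr0 addr0.
have [|g gE] := IHm (2^-1 *: (f - (f \Po ('X + 1)))).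
  apply: leq_trans sf; rewrite (leq_ltn_trans (size_scale_leq _ _))//.
  exact: size_shift_sub.
exists (g + f) => x; rewrite !hornerD addrACA gE hornerZ hornerD hornerN.
have -> : (f \Po ('X + 1)).[x] = f.[x + 1] by rewrite horner_comp !hornerE.
by field.
Qed.

Section integral.
Context {R : realType} {p : nat} (p_prime : prime p) (p_odd : odd p)
  (Cp : padicComplexType p R).

(** The integrand is any function with a polynomial primitive along the natural
    numbers; the alternating sum telescopes, and the remaining boundary term
    g (p^N) tends to g (0). *)
Lemma fermionic_integral_primitive (g : {poly Cp}) (f : Cp -> Cp) :
  (forall y : nat, g.[y%:R + 1] + g.[y%:R] = 2 * f y%:R) ->
  fermionic_integral f = g.[0].
Proof.
move=> gf; have two : 2 != 0 :> Cp by exact: padic_natr_neq0.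
have sumE M : 2 * \sum_(0 <= y < M) f y%:R * (-1) ^+ y =
    g.[0] - (-1) ^+ M * g.[M%:R].
  elim: M => [|M IHM]; first by rewrite big_nil expr0; ring.
  rewrite big_nat_recr//= mulrDr IHM mulrA -gf exprS -(natr1 M); ring.
have [h hE] : exists h : {poly Cp}, g = h * 'X + g.[0]%:P.
  have : root (g - g.[0]%:P) 0 by rewrite rootE !hornerE subrr.
  case/factor_theorem => h; rewrite subr0 => hE.
  by exists h; rewrite -hE subrK.
have gE x : g.[x] = h.[x] * x + g.[0].
  by rewrite {1}hE hornerD hornerM hornerX hornerC.
have [C C0 hC] := horner_bounded _ h.
have a2 : 0 < absv (2^-1 : Cp).
  by rewrite lt_neqAle absv_ge0 eq_sym absv_eq0 invr_eq0 two.
apply: cvg_lim; first exact: ultrametric_hausdorff.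
apply/cvg_ballP => e e0; rewrite ball_absvE.
near=> N => /=.
have -> : g.[0] - \sum_(0 <= y < p ^ N) f y%:R * (-1) ^+ y =
    (p ^ N)%:R * (- (2^-1) * h.[(p ^ N)%:R]).
  (* p ^ N is odd, which turns the sign of the boundary term into a plus. *)
  apply: (mulfI two); rewrite mulrBr sumE -signr_odd oddX p_odd orbT expr1.
  by rewrite (gE (p ^ N)%:R); field.
rewrite absvM absvM absvN.
apply: (@le_lt_trans _ _ (absv ((p ^ N)%:R : Cp) * (absv (2^-1 : Cp) * C))).
  by rewrite !ler_wpM2l ?absv_ge0// hC ?absv_nat_le1.
rewrite -ltr_pdivlMr ?mulr_gt0//; near: N.
apply: absv_powp_lt => //; exact: divr_gt0 (mulr_gt0 a2 C0).
Unshelve. all: by end_near. Qed.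

(** Linear combinations are taken on the polynomial primitives, so the limits
    themselves never have to be added. *)
Lemma fermionic_integral_sum (n : nat) (c : nat -> Cp) (P : nat -> {poly Cp})
    (f : Cp -> Cp) :
  (forall y : nat, f y%:R = \sum_(l < n) c l * (P l).[y%:R]) ->
  fermionic_integral f = \sum_(l < n) c l * fermionic_integral (horner (P l)).
Proof.
move=> fE; have two : 2 != 0 :> Cp by exact: padic_natr_neq0.
have [G GE] := choice (fun l => euler_primitive two (P l)).
rewrite (@fermionic_integral_primitive (\sum_(l < n) c l *: G l)) => [|y].
  rewrite horner_sum; apply: eq_bigr => l _.
  by rewrite hornerZ (@fermionic_integral_primitive (G l)).
rewrite !horner_sum -big_split fE mulr_sumr; apply: eq_bigr => l _ /=.
by rewrite !hornerZ -mulrDr GE mulrCA.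
Qed.

End integral.

(** * Identities between q-products *)

Section qprod.
Context {R : realType} {p : nat} (Cp : padicComplexType p R).
Implicit Types x q : Cp.

Lemma qprodS q n x : qprod q n.+1 x = qprod q n x * (x - n%:R * q).
Proof. by rewrite /qprod big_ord_recr. Qed.

Lemma qprod_shift q n x : qprod q n.+1 (x + q) = (x + q) * qprod q n x.
Proof.
rewrite /qprod big_ord_recl mul0r subr0; congr (_ * _); apply: eq_bigr => i _.
by rewrite lift0 -natr1; move: (i%:R : Cp) => a; ring.
Qed.

(** After the sign is absorbed the factors are x + i q for i < n; read from the
    last to the first they form a q-product starting at x + (n - 1) q. For n = 0
    both products are empty, whatever the truncated predecessor is. *)
Lemma qprod_opp q n x :
  (-1) ^+ n * qprod q n (- x) = qprod q n (x + n.-1%:R * q).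
Proof.
case: n => [|n]; first by rewrite /qprod !big_ord0 mulr1.
rewrite -[in (-1) ^+ _](card_ord n.+1) -prodr_const -big_split /qprod /=.
rewrite (reindex_inj rev_ord_inj); apply: eq_bigr => i _.
have in1 : (i <= n)%N by rewrite -ltnS.
rewrite /= subSS (natrB _ in1).
move: (i%:R : Cp) (n%:R : Cp) => a b; ring.
Qed.

(** The ordinary binomial coefficient of x / q over n. *)
Definition qbin q n x : Cp := qprod q n x / (n`!%:R * q ^+ n).

Section vandermonde.
Context (p_prime : prime p) (q : Cp) (q0 : q != 0).

Lemma qbin_pascal n x : qbin q n.+1 (x + q) = qbin q n.+1 x + qbin q n x.
Proof.
have n0 : n.+1%:R != 0 :> Cp by exact: padic_natr_neq0.
have f0 : n`!%:R != 0 :> Cp by apply: padic_natr_neq0; rewrite // fact_gt0.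
rewrite /qbin qprod_shift qprodS factS natrM exprS -natr1 in n0 *.
by field; rewrite q0 f0 n0 expf_neq0.
Qed.

(** Induction on m: one more shift by q applies Pascal's rule to the left-hand
    side and to the coefficients C(m, n - l) on the right-hand side. *)
Lemma qbin_vandermonde m n x :
  qbin q n (x + m%:R * q) = \sum_(l < n.+1) 'C(m, n - l)%:R * qbin q l x.
Proof.
elim: m n => [|m IHm] n.
  rewrite mul0r addr0 big_ord_recr/= subnn bin0 mul1r big1 ?add0r// => l _.
  by rewrite bin0n subn_eq0 leqNgt ltn_ord mul0r.
rewrite -natr1 mulrDl mul1r addrA; case: n => [|n].
  by rewrite big_ord1 /= bin0 mul1r /qbin /qprod !big_ord0.
rewrite qbin_pascal !IHm big_ord_recr [RHS]big_ord_recr/= !subnn !bin0.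
rewrite addrAC -big_split/=; congr (_ + _); apply: eq_bigr => l _.
by rewrite subSn -1?ltnS// binS natrD mulrDl.
Qed.

End vandermonde.

Lemma qprod_horner q n (lambda : Cp) : exists P : {poly Cp},
  forall y, P.[y] = qprod q n (lambda * y).
Proof.
exists (\prod_(i < n) (lambda *: 'X - (i%:R * q)%:P)) => y.
by rewrite horner_prod; apply: eq_bigr => i _; rewrite !hornerE.
Qed.

End qprod.

Theorem theorem2p6 (R : realType) (p : nat) (p_prime : prime p) (p_odd : odd p)
    (Cp : padicComplexType p R) (lambda q : Cp)
    (lambda_Zp : padic_integers lambda)
    (q_near1 : absv (1 - q) < p%:R `^ (- (p.-1)%:R^-1)) (n : nat) :
  (-1) ^+ n / q ^+ n * (Bl_hat q lambda n / n`!%:R) =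
  \sum_(l < n.+1) 'C(n.-1, n - l)%:R * (Bl q lambda l / (l`!%:R * q ^+ l)).
Proof.
have q0 : q != 0.
  apply/eqP => q0; move: q_near1; rewrite q0 subr0 absv1 ltNge => /negP; apply.
  rewrite -[leRHS](powRr0 p%:R) ler_powR// ?oppr_le0 ?invr_ge0//.
  by rewrite ler1n prime_gt0.
have [P PE] := choice (fun l => qprod_horner Cp q l lambda).
have BlE l : Bl q lambda l = fermionic_integral (horner (P l)).
  by congr fermionic_integral; apply/funext => y; rewrite PE.
have f0 m : m`!%:R != 0 :> Cp by apply: padic_natr_neq0; rewrite // fact_gt0.
(* d clears the sign and the denominator of the left-hand side, which is then
   the integral itself. *)
pose d := (-1) ^+ n * (q ^+ n * n`!%:R) : Cp.
pose c l := d * ('C(n.-1, n - l)%:R / (l`!%:R * q ^+ l)).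
have -> : Bl_hat q lambda n = \sum_(l < n.+1) c l * Bl q lambda l.
  under eq_bigr => l _ do rewrite BlE.
  apply: fermionic_integral_sum => // y.
  transitivity (d * qbin Cp q n (lambda * y%:R + n.-1%:R * q)).
    rewrite /qbin -qprod_opp /d mulNr.
    (* The sign enters d and the reflection: it cancels as its square is 1. *)
    rewrite -[LHS]mul1r -[X in X * _ = _](sqrr_sign _ n).
    by field; rewrite f0 expf_neq0.
  rewrite qbin_vandermonde// mulr_sumr; apply: eq_bigr => l _.
  by rewrite PE /qbin /c; ring.
rewrite mulr_suml mulr_sumr; apply: eq_bigr => l _; rewrite /c /d.
rewrite -[RHS]mul1r -[X in _ = X * _](sqrr_sign _ n).
by field; rewrite !f0 !expf_neq0.
Qed.
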